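(* If $G$ is a graph of order $n$, then $d(G) \geq \lceil \frac{n}{2} \rceil$.
   Context: Graphs are finite and simple; the order of a graph is its number of vertices. The deduction game on a graph $G$: a layout is a placement of searchers on vertices of $G$ (a vertex may receive several searchers). A vertex is occupied in the layout if it contains at least one searcher, and unoccupied otherwise. A vertex is protected if it is occupied in the initial layout or if a searcher has moved there at some point, and unprotected otherwise. A vertex is fireable if the number of searchers on it is greater than or equal to the number of its unprotected neighbours. Initially every searcher is mobile; once a searcher has moved once, it becomes immobile (cannot move again). At each stage, simultaneously, for every fireable vertex $v$ containing mobile searchers, one searcher moves from $v$ to each unprotected neighbour of $v$ (excess searchers stay on $v$; several fireable vertices may send a searcher to the same target). Stages continue until no new searchers move. The layout is successful if at the end all vertices of $G$ are protected. The deduction number $d(G)$ is the minimum number of searchers in a successful layout on $G$. *)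

(* Defs.v *)
From mathcomp Require Import all_boot.

Set Implicit Arguments.
Unset Strict Implicit.
Unset Printing Implicit Defensive.

Section DeductionGame.

(* The graph: adjacency relation [e] on the vertex set [T]; symmetry and
   irreflexivity are hypotheses of the theorems, not of the game. *)
Variables (T : finType) (e : rel T).

Definition layout := {ffun T -> nat}.

Definition searchers (L : layout) : nat := \sum_v L v.

Definition occupied (L : layout) : {set T} := [set v | 0 < L v].

(* Searchers are indistinguishable, so a position records, for each vertex,
   how many mobile and how many immobile searchers stand on it. *)
Record position := Position {
  protected : {set T};
  mobile : {ffun T -> nat};
  immobile : {ffun T -> nat}
}.

Definition initial (L : layout) : position :=
  Position (occupied L) L [ffun=> 0].

Definition unprotected_nbrs (p : position) (v : T) : {set T} :=
  [set w | e v w & w \notin protected p].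

Definition fireable (p : position) (v : T) : bool :=
  #|unprotected_nbrs p v| <= mobile p v + immobile p v.

Definition fires (p : position) (v : T) : bool :=
  fireable p v && (0 < mobile p v).

(* The vertices sending a searcher to [w]. *)
Definition senders (p : position) (w : T) : {set T} :=
  [set v | fires p v & w \in unprotected_nbrs p v].

(* The truncated subtraction is exact in every position that can be reached,
   see [fires_mobile] below. *)
Definition stage (p : position) : position :=
  Position
    (protected p :|: [set w | senders p w != set0])
    [ffun v => if fires p v then mobile p v - #|unprotected_nbrs p v|
               else mobile p v]
    [ffun w => immobile p w + #|senders p w|].

Definition moving (p : position) : bool :=
  [exists w, senders p w != set0].

Definition play (L : layout) (k : nat) : position := iter k stage (initial L).

Lemma fires_mobile (L : layout) (k : nat) (v : T) :
  fires (play L k) v -> #|unprotected_nbrs (play L k) v| <= mobile (play L k) v.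
Proof.
suff inv : 0 < mobile (play L k) v ->
    (v \in protected (play L k)) && (immobile (play L k) v == 0).
  by case/andP=> + /inv/andP[_ /eqP i0]; rewrite /fireable i0 addn0.
elim: k => [|k IHk]; first by rewrite /= inE ffunE => ->.
rewrite /play iterS -/(play L k) /= !ffunE => mv.
have /IHk/andP[pv /eqP->] : 0 < mobile (play L k) v.
  by move: mv; case: ifP => // _ /leq_trans; apply; apply: leq_subr.
rewrite inE pv /= cards_eq0; apply/eqP/setP => u.
by rewrite !inE pv !andbF.
Qed.

Lemma play_stops (L : layout) : exists k, ~~ moving (play L k).
Proof.
have grow k : (exists j, ~~ moving (play L j)) \/ k <= #|protected (play L k)|.
  elim: k => [|k [|IHk]]; [by right | by left |].
  have [mov|] := boolP (moving (play L k)); last by left; exists k.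
  right; apply: leq_ltn_trans IHk _; apply: proper_card.
  rewrite properE subsetUl /=; have [w sw] := existsP mov.
  have [u] := set0Pn _ sw; rewrite !inE => /and3P[_ _ pw].
  apply/subsetPn; exists w => //.
  by rewrite !inE sw orbT.
have [//|] := grow #|T|.+1.
by rewrite ltnNge max_card.
Qed.

Definition final (L : layout) : position :=
  play L (ex_minn (play_stops L)).

Definition successful (L : layout) : bool :=
  protected (final L) == [set: T].

(* A layout with [k] searchers has at most [k] of them on each vertex, so it is
   enough to search a finite type of layouts, see [deducibleP]. *)
Definition deducible (k : nat) : bool :=
  [exists f : {ffun T -> 'I_k.+1},
    let L : layout := [ffun v => f v : nat] in
    (searchers L == k) && successful L].

Lemma deducibleP (k : nat) :
  reflect (exists L : layout, searchers L = k /\ successful L) (deducible k).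
Proof.
apply: (iffP existsP) => [[f /andP[/eqP Lk sL]]|[L [Lk sL]]].
  by exists [ffun v => f v : nat].
have leL v : L v < k.+1 by rewrite ltnS -Lk /searchers (bigD1 v) //= leq_addr.
exists [ffun v => Ordinal (leL v)] => /=.
have -> : [ffun v => [ffun v => Ordinal (leL v)] v : nat] = L.
  by apply/ffunP=> v; rewrite !ffunE.
by rewrite Lk eqxx.
Qed.

Lemma deducible_order : exists k, deducible k.
Proof.
exists #|T|; apply/deducibleP; exists [ffun=> 1]; split.
  by rewrite /searchers (eq_bigr (fun=> 1)) ?sum1_card // => v _; rewrite ffunE.
have mono k : occupied [ffun=> 1] \subset protected (play [ffun=> 1] k).
  elim: k => // k /subset_trans; apply; exact: subsetUl.
rewrite /successful -subTset; apply: subset_trans (mono _).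
by apply/subsetP=> v _; rewrite inE ffunE.
Qed.

Definition deduction_number : nat := ex_minn deducible_order.

End DeductionGame.

(* Main.v *)
Require Import Defs.
From mathcomp Require Import all_boot.

(** Every searcher accounts for at most two protected vertices: the one on
    which it is placed and the one to which it makes its only move. This is
    turned into an invariant by counting the searchers who have yet to move:
    the number of protected vertices plus the number of mobile searchers never
    exceeds twice the number of searchers. It holds initially, because there are
    at most as many occupied vertices as searchers and all searchers are mobile
    ([card_occupied]). A stage preserves it, because each newly protected vertex
    receives at least one searcher that becomes immobile ([stage_protected],
    [play_mobile]). In a successful layout all vertices end up protected, so
    there are at most twice as many vertices as searchers. *)

Section SearcherCount.

Variables (T : finType) (e : rel T).
Implicit Types (L : layout T) (p : position T).

Lemma card_occupied L : #|occupied L| <= searchers L.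
Proof.
rewrite -sum1_card big_mkcond; apply: leq_sum => v _.
by rewrite inE; case: (L v).
Qed.

(** The newly protected vertices are the union, over the firing vertices, of
    their unprotected neighbourhoods. These may overlap, hence the
    inequality. *)
Lemma stage_protected p :
  #|protected (stage e p)| <=
    #|protected p| + \sum_(v | fires e p v) #|unprotected_nbrs e p v|.
Proof.
have -> : protected (stage e p) =
    protected p :|: \bigcup_(v | fires e p v) unprotected_nbrs e p v.
  congr (_ :|: _); apply/setP => w; rewrite inE.
  apply/set0Pn/bigcupP => [[v]|[v fv wv]].
    by rewrite inE => /andP[fv wv]; exists v.
  by exists v; rewrite inE fv.
apply: leq_trans (leq_card_setU _ _) _; rewrite leq_add2l.
elim/big_ind2: _ => [|A m B n leAm leBn|//]; first by rewrite cards0.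
exact: leq_trans (leq_card_setU _ _) (leq_add leAm leBn).
Qed.

(** A firing vertex loses exactly one mobile searcher for each unprotected
    neighbour: [fires_mobile] says that the truncated subtraction in [stage]
    is exact along a play. *)
Lemma play_mobile L k :
  \sum_v mobile (play e L k.+1) v +
      \sum_(v | fires e (play e L k) v) #|unprotected_nbrs e (play e L k) v| =
    \sum_v mobile (play e L k) v.
Proof.
rewrite [X in _ + X]big_mkcond -big_split; apply: eq_bigr => v _ /=.
rewrite ffunE -/(play e L k); case: ifP => [fv|_]; last exact: addn0.
by rewrite subnK // fires_mobile.
Qed.

Lemma play_protected_mobile L k :
  #|protected (play e L k)| + \sum_v mobile (play e L k) v <=
    (searchers L).*2.
Proof.
elim: k => [|k IHk]; first by rewrite -addnn leq_add2r card_occupied.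
apply: leq_trans IHk; rewrite -(play_mobile L k) [leqRHS]addnCA [leqLHS]addnC leq_add2l.
exact: stage_protected.
Qed.

Lemma successful_card L : successful e L -> #|T| <= (searchers L).*2.
Proof.
move=> /eqP protT; rewrite -cardsT -protT.
exact: leq_trans (leq_addr _ _) (play_protected_mobile _ _).
Qed.

End SearcherCount.

Theorem theorem3p2 (T : finType) (e : rel T)
  (e_sym : symmetric e) (e_irr : irreflexive e) :
  uphalf #|T| <= deduction_number e.
Proof.
rewrite /deduction_number; case: ex_minnP => k /deducibleP[L [<- sL]] _.
by rewrite leq_uphalf_double (successful_card _ _ _ sL).
Qed.
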